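(* Let $G$ be an $n$-vertex graph with independence number $2$, and let $\ell \le \lceil n/2 \rceil - 1$ be a positive integer. Then $G$ contains an immersion of the complete bipartite graph $K_{\ell, \lceil n/2 \rceil - \ell}$.
   Context: All graphs are finite and loopless (parallel edges are allowed). The independence number of a graph is the maximum size of an independent set of vertices. $K_{a,b}$ denotes the complete bipartite graph with parts of sizes $a$ and $b$. A graph $G$ contains an immersion of a graph $H$ if there exist an injection $f \colon V(H) \to V(G)$ and a collection of pairwise edge-disjoint paths in $G$, one for each edge of $H$, such that the path corresponding to an edge joining $u$ and $v$ has endvertices $f(u)$ and $f(v)$. (Paths may pass through vertices in the image of $f$.) *)

(* Defs.v *)
From mathcomp Require Import all_boot.

Set Implicit Arguments.
Unset Strict Implicit.
Unset Printing Implicit Defensive.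

(* Finite loopless multigraphs: an edge is an object of its own, with a set of
   exactly two endvertices, so that parallel edges may have the same [ends]. *)
Record mgraph := MGraph {
  vertex : finType;
  edge : finType;
  ends : edge -> {set vertex};
  card_ends : forall e, #|ends e| = 2
}.

Definition adjacent (G : mgraph) (u v : vertex G) : bool :=
  [exists e : edge G, ends e == [set u; v]].

Definition independent (G : mgraph) (S : {set vertex G}) : bool :=
  [forall u in S, forall v in S, ~~ adjacent u v].

Definition independence_number (G : mgraph) : nat :=
  \max_(S : {set vertex G} | independent S) #|S|.

(* The sequence [:: (e1, x1); ...; (ek, xk)], read from x, stands for the walk
   x, e1, x1, ..., ek, xk. *)
Fixpoint is_walk (G : mgraph) (x : vertex G)
    (w : seq (edge G * vertex G)) : bool :=
  if w is (e, y) :: w' then (ends e == [set x; y]) && is_walk y w' else true.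

Definition walk_edges (G : mgraph) (w : seq (edge G * vertex G)) :
  seq (edge G) := unzip1 w.

Definition walk_target (G : mgraph) (x : vertex G)
  (w : seq (edge G * vertex G)) : vertex G := last x (unzip2 w).

Definition is_path (G : mgraph) (x : vertex G)
    (w : seq (edge G * vertex G)) : bool :=
  is_walk x w && uniq (x :: unzip2 w).

(* Edges of H are unoriented, so each path may be traversed from either end:
   only the set of its two endvertices is prescribed. *)
Definition contains_immersion (G H : mgraph) : Prop :=
  exists (f : vertex H -> vertex G)
         (src : edge H -> vertex G)
         (P : edge H -> seq (edge G * vertex G)),
    [/\ injective f,
        forall e, is_path (src e) (P e),
        forall e, [set src e; walk_target (src e) (P e)] = f @: ends e
      & forall e1 e2, e1 != e2 ->
          [disjoint walk_edges (P e1) & walk_edges (P e2)]].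

Definition Kbip_ends (a b : nat) (e : 'I_a * 'I_b) : {set 'I_a + 'I_b} :=
  [set inl e.1; inr e.2].

Lemma card_Kbip_ends (a b : nat) (e : 'I_a * 'I_b) : #|Kbip_ends e| = 2.
Proof. by rewrite cards2. Qed.

Definition Kbip (a b : nat) : mgraph := MGraph (@card_Kbip_ends a b).

(* Main.v *)
Require Import Defs.
From mathcomp Require Import all_boot zify.

Set Implicit Arguments.
Unset Strict Implicit.
Unset Printing Implicit Defensive.

(** Write H for the graph of non-adjacent pairs of distinct vertices of G; the
    independence number being at most 2 means that H has no triangle, so that
    two distinct vertices with a common H-neighbour are adjacent in G
    ([adj_of_common]).  By induction on a + b, every vertex set S with
    2(a + b) <= |S| + 1 contains an immersion of K_{a,b} whose routes stay
    inside S ([has_biclique_half]).  Let b <= a.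

    If some non-adjacent u, v in S have at least b common neighbours in S, take
    a K_{a-1,b} inside S minus u, v and add u to the side of size a - 1.  A
    vertex y of the other side that is not adjacent to u is adjacent to v, and
    is reached along u, h(y), v, y for a common neighbour h(y) of u and v
    outside that side; there are enough common neighbours to make h injective
    ([has_biclique_extend]).

    Otherwise every edge xy of H leaves fewer than b vertices of S H-adjacent to
    neither x nor y, and some set Q of at least a + b vertices can serve as the
    branch vertices, however the two sides are taken in it.
    - If H has no closed walk of length 5 in S, then either S splits into two
      cliques of G, the vertices at distance 0 or 2 in H from a fixed vertex
      and all others, or some vertex has many H-neighbours, which form a clique
      of G; so Q can be a clique ([has_biclique_or_five_cycle]).
    - If v1 ... v5 is a 5-cycle of H, let U_i consist of the vertices
      H-adjacent to both v_{i-1} and v_{i+1}, indices being modulo 5.  The U_i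
      are disjoint, and each U_i, as well as the union of U_i and U_{i+2}, is a
      clique of G.  A vertex outside U_i, U_{i+1} and U_{i+3} is H-adjacent to
      neither end of one of two edges of the cycle; hence these three sets have
      together at least |S| - 2(b - 1) >= a + b elements ([five_cycle_cover]).
      After a rotation |U_1| <= |U_5|.  If U_1 and U_4 have together fewer
      than a + b elements, complete them to Q by a subset R of U_2; the same
      count gives |R| <= |U_3|.  Only a pair (x, y) of U_1 and R can fail to be
      adjacent, and it is joined by x, f(y), g(x), y for
      injections f : R -> U_3 and g : U_1 -> U_5: as f depends on y only and g
      on x only, these routes are edge-disjoint ([has_biclique_detours]). *)

(** * Finite sets *)

Lemma set2_eq (T : finType) (a b c d : T) :
  [set a; b] = [set c; d] -> (a = c /\ b = d) \/ (a = d /\ b = c).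
Proof.
move=> E; have := (set21 a b, set22 a b, set21 c d, set22 c d).
rewrite {1 2}E -{3 4}E !inE => -[[[]]].
by move=> /orP[]/eqP ? /orP[]/eqP ? /orP[]/eqP ? /orP[]/eqP ?; subst; auto.
Qed.

Lemma exists_subset_card (T : finType) (A : {set T}) n :
  n <= #|A| -> exists2 B : {set T}, B \subset A & #|B| = n.
Proof.
move=> nA; exists [set:: take n (enum A)].
  by apply/subsetP=> x; rewrite inE => /mem_take; rewrite mem_enum.
rewrite cardsE (card_uniqP (take_uniq n (enum_uniq A))) size_takel //.
by rewrite -cardE.
Qed.

Lemma exists_injection (T : finType) (X Y : {set T}) :
  #|X| <= #|Y| ->
  exists h : T -> T, (forall x, x \in X -> h x \in Y) /\ {in X &, injective h}.
Proof.
move=> XY; case: (set_0Vmem X) => [->|[x0 _]].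
  by exists id; split=> [x|x y]; rewrite inE.
have bound x : x \in X -> index x (enum X) < size (enum Y).
  by move=> xX; rewrite -cardE; apply: leq_trans XY; rewrite cardE index_mem mem_enum.
exists (fun x => nth x0 (enum Y) (index x (enum X))); split=> [x xX|x y xX yX /eqP].
  by rewrite -mem_enum mem_nth ?bound.
rewrite nth_uniq ?bound ?enum_uniq // => /eqP /(congr1 (nth x0 (enum X))).
by rewrite !nth_index ?mem_enum.
Qed.

(** * Bicliques linked by edge-disjoint routes *)

Section Linking.

Variables (T : finType) (adj : rel T).
Hypothesis adj_sym : symmetric adj.
Hypothesis adj_irr : irreflexive adj.

Definition nonadj x y := (x != y) && ~~ adj x y.

Lemma nonadj_sym : symmetric nonadj.
Proof. by move=> x y; rewrite /nonadj eq_sym adj_sym. Qed.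

Hypothesis nonadj_triangle_free :
  forall x y z, nonadj x y -> nonadj y z -> ~~ nonadj x z.

Lemma no_triangle x y z : nonadj x y -> nonadj x z -> nonadj y z -> False.
Proof.
by rewrite nonadj_sym => yx xz yz; move/negP: (nonadj_triangle_free yx xz).
Qed.

Lemma adj_of_common x y c : nonadj x c -> nonadj y c -> x != y -> adj x y.
Proof.
rewrite (nonadj_sym y) => xc cy xy.
by have := nonadj_triangle_free xc cy; rewrite /nonadj xy negbK.
Qed.

(** A route is given by its set of edges, each edge by its set of two ends:
    being a route from x to y then means connecting x to y, which is symmetric
    in x and y and leaves the extraction of a simple path to the end. *)
Definition within (F : {set {set T}}) : rel T :=
  [rel x y | adj x y && ([set x; y] \in F)].

Lemma within_connect_sym F : connect_sym (within F).
Proof. by apply: sym_connect_sym => x y; rewrite /within /= adj_sym setUC. Qed.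

(** The second condition keeps the routes inside [S]; it makes those of an
    immersion in a smaller set disjoint from any edge that leaves this set. *)
Definition linked (S A B : {set T}) : Prop :=
  exists F : T -> T -> {set {set T}},
  [/\ forall x y, x \in A -> y \in B -> connect (within (F x y)) x y,
      forall x y e, x \in A -> y \in B -> e \in F x y -> e \subset S
    & forall x y x' y' e, x \in A -> y \in B -> x' \in A -> y' \in B ->
        e \in F x y -> e \in F x' y' -> x = x' /\ y = y'].

Definition has_biclique (S : {set T}) (a b : nat) : Prop :=
  exists A B : {set T},
  [/\ A \subset S, B \subset S & [disjoint A & B]] /\
  [/\ #|A| = a, #|B| = b & linked S A B].

Lemma has_biclique_sym S a b : has_biclique S a b -> has_biclique S b a.
Proof.
move=> [A [B [[AS BS dAB] [cA cB [F [F1 F2 F3]]]]]].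
exists B, A; split; first by rewrite disjoint_sym.
split=> //; exists (fun x y => F y x); split=> [x y xB yA|x y e xB yA|].
- by rewrite within_connect_sym F1.
- exact: F2.
- by move=> x y x' y' e xB yA x'B y'A eF /(F3 _ _ _ _ _ yA xB y'A x'B eF) [].
Qed.

Lemma connect_edge x y : adj x y -> connect (within [set [set x; y]]) x y.
Proof. by move=> xy; apply: connect1; rewrite /within /= xy set11. Qed.

Definition detour x c d y : {set {set T}} :=
  [set [set x; c]; [set c; d]; [set d; y]].

Lemma connect_detour x c d y :
  adj x c -> adj c d -> adj d y -> connect (within (detour x c d y)) x y.
Proof.
move=> xc cd dy; apply/connectP; exists [:: c; d; y]; rewrite /within //=.
by rewrite xc cd dy !inE !eqxx ?orbT.
Qed.

Lemma sub_set2 (x y : T) (S : {set T}) : x \in S -> y \in S -> [set x; y] \subset S.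
Proof. by move=> xS yS; apply/subsetP=> z; rewrite !inE => /orP[]/eqP->. Qed.

Lemma detour_sub x c d y e (S : {set T}) :
  x \in S -> c \in S -> d \in S -> y \in S -> e \in detour x c d y ->
  e \subset S.
Proof.
by move=> xS cS dS yS; rewrite !inE -orbA => /or3P[]/eqP->; apply: sub_set2.
Qed.

Definition common_nbrs (S : {set T}) u v :=
  [set w in S | ~~ nonadj w u & ~~ nonadj w v].

(** This is the induction step.  The non-neighbours [N] of [u] in [B] are
    neighbours of [v] that lie outside the common neighbours [C] of [u] and [v],
    so |N| <= b - |B :&: C| <= |C :\: B|: each of them gets a private detour
    vertex [h y], and the edges [u, h y] are not among the edges [u, y] used to
    reach the vertices of [B] adjacent to [u]. *)
Lemma has_biclique_extend (S : {set T}) u v a b :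
  u \in S -> v \in S -> nonadj u v -> b <= #|common_nbrs S u v| ->
  has_biclique (S :\ u :\ v) a b -> has_biclique S a.+1 b.
Proof.
move=> uS vS uv bC [A [B [[AS BS dAB] [cA cB [F [F1 F2 F3]]]]]].
set C := common_nbrs S u v in bC.
have vu : v != u by rewrite eq_sym; case/andP: uv.
have CP w : w \in C -> [/\ w \in S, adj u w, adj w v, w != u & w != v].
  rewrite inE => /andP[wS /andP[wu wv]].
  have wNu : w != u.
    by apply: contraNneq wv => ->.
  have wNv : w != v.
    by apply: contraNneq wu => ->; rewrite nonadj_sym.
  split=> //.
    by move: wu; rewrite /nonadj wNu negbK adj_sym.
  by move: wv; rewrite /nonadj wNv negbK.
have sub0 (D : {set T}) x : D \subset S :\ u :\ v -> x \in D ->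
    [/\ x \in S, x != u & x != v].
  by move=> /subsetP DS /DS; rewrite !inE => /and3P[].
have uA : u \notin A by apply/negP=> /(sub0 _ _ AS) [_ /eqP].
have uB : u \notin B by apply/negP=> /(sub0 _ _ BS) [_ /eqP].
have vB : v \notin B by apply/negP=> /(sub0 _ _ BS) [_ _ /eqP].
pose N := [set y in B | ~~ adj u y].
have NP y : y \in N -> y \in B /\ adj v y.
  rewrite inE => /andP[yB uy]; split=> //.
  have [yS yu yv] := sub0 _ _ BS yB.
  apply: (@adj_of_common _ _ u); rewrite ?(nonadj_sym v) //.
    by rewrite /nonadj yu adj_sym.
  by rewrite eq_sym.
have [h [hC h_inj]] : exists h : T -> T,
    (forall x, x \in N -> h x \in C :\: B) /\ {in N &, injective h}.
  apply: exists_injection.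
  have NB : N \subset B :\: C.
    apply/subsetP=> y yN; have [yB _] := NP _ yN; rewrite in_setD yB andbT.
    apply/negP=> /CP[_ uy _ _ _].
    by move: yN; rewrite inE uy andbF.
  apply: leq_trans (subset_leq_card NB) _.
  by rewrite !cardsD setIC leq_sub2r // cB.
have hP y : y \in N -> [/\ h y \notin B, h y \in S, adj u (h y) & adj (h y) v].
  by move=> /hC; rewrite in_setD => /andP[hB /CP[]].
pose F' x y := if x == u then
  (if adj u y then [set [set u; y]] else detour u (h y) v y) else F x y.
(* The new routes are disjoint from the old ones: each of their edges meets
   {u, v}, which the old routes avoid. *)
have new_meets y e : y \in B -> e \in F' u y -> ~~ (e \subset S :\ u :\ v).
  move=> yB; rewrite /F' eqxx; case: ifP => uy.
    rewrite inE => /eqP->; apply/negP=> /subsetP/(_ u).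
    by rewrite !inE !eqxx andbF => /(_ isT).
  have notin c d : (c == u) || (c == v) || (d == u) || (d == v) ->
      ~~ ([set c; d] \subset S :\ u :\ v).
    move=> cd; apply/negP=> /subsetP s.
    move: (s c) (s d) cd; rewrite !inE !eqxx !orbT => /(_ isT) cS /(_ isT) dS.
    by case/and3P: cS => /negPf-> /negPf-> _; case/and3P: dS => /negPf-> /negPf->.
  by rewrite !inE -orbA => /or3P[]/eqP->; apply: notin; rewrite eqxx ?orbT.
have new_inj y y' e : y \in B -> y' \in B -> e \in F' u y -> e \in F' u y' ->
    y = y'.
  move=> yB y'B; rewrite /F' eqxx.
  have neq z : z \in B -> z <> u /\ z <> v.
    by move=> zB; split=> E; [move: uB|move: vB]; rewrite -E zB.
  have [yu yv] := neq _ yB; have [y'u y'v] := neq _ y'B.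
  have uv' : u <> v by move=> E; rewrite E eqxx in vu.
  have hn z : z \in B -> ~~ adj u z ->
      [/\ h z <> u, h z <> v, h z <> y & h z <> y'].
    move=> zB uz; have /hP[hB _ uh hv] : z \in N by rewrite inE zB.
    by split=> E; [rewrite E adj_irr in uh|rewrite E adj_irr in hv|
      rewrite E yB in hB|rewrite E y'B in hB].
  have hin : ~~ adj u y -> ~~ adj u y' -> h y = h y' -> y = y'.
    by move=> uy uy'; apply: h_inj; rewrite inE ?yB ?y'B.
  case: ifP => uy; case: ifP => uy'; rewrite ?inE -?orbA.
  - by move=> /eqP-> /eqP/set2_eq; intuition congruence.
  - have [? ? ? ?] := hn _ y'B (negbT uy').
    by move=> /eqP-> /or3P[]/eqP/set2_eq; intuition congruence.
  - have [? ? ? ?] := hn _ yB (negbT uy).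
    by move=> /or3P[]/eqP-> /eqP/set2_eq; intuition congruence.
  - have [? ? ? ?] := hn _ y'B (negbT uy').
    have [? ? ? ?] := hn _ yB (negbT uy).
    have := hin (negbT uy) (negbT uy').
    by move=> ? /or3P[]/eqP-> /or3P[]/eqP/set2_eq; intuition congruence.
have A'P x : x \in u |: A -> x = u \/ (x != u /\ x \in A).
  by rewrite in_setU1; case: eqVneq => [->|_ /= xA]; auto.
have F'old x : x != u -> F' x = F x by rewrite /F' => /negPf->.
exists (u |: A), B; split; split=> //.
- rewrite subUset sub1set uS /=; apply/subsetP=> x /(sub0 _ _ AS) [] //.
- by apply/subsetP=> x /(sub0 _ _ BS) [].
- by rewrite disjoints_subset subUset sub1set inE uB -disjoints_subset.
- by rewrite cardsU1 uA cA.
exists F'; split.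
- move=> x y /A'P[->|[xu xA]] yB; last by rewrite F'old // F1.
  rewrite /F' eqxx; case: ifP => uy; first exact: connect_edge.
  have yN : y \in N by rewrite inE yB uy.
  have [_ _ uh hv] := hP _ yN; have [_ vy] := NP _ yN.
  exact: connect_detour.
- move=> x y e /A'P[->|[xu xA]] yB; last first.
    by rewrite F'old // => /(F2 _ _ _ xA yB)/subset_trans; apply;
       apply/subsetP=> z; rewrite !inE => /and3P[].
  have [yS _ _] := sub0 _ _ BS yB.
  rewrite /F' eqxx; case: ifP => uy; first by rewrite inE => /eqP->; apply: sub_set2.
  have /hP[_ hS _ _] : y \in N by rewrite inE yB uy.
  exact: detour_sub.
- move=> x y x' y' e /A'P[->|[xu xA]] yB /A'P[->|[x'u x'A]] y'B.
  + by move=> e1 e2; split=> //; apply: new_inj e1 e2.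
  + by move=> /(new_meets _ _ yB)/negP eS; rewrite F'old // => /(F2 _ _ _ x'A y'B).
  + rewrite F'old // => /(F2 _ _ _ xA yB) eS.
    by move=> /(new_meets _ _ y'B)/negP.
  + by rewrite !F'old //; apply: F3.
Qed.

(** The middle vertices of a detour x, f y, g x, y lie outside [Q]; since [f]
    and [g] are injective, each of its three edges determines both x and y.
    Hence the detours are edge-disjoint from each other and from the edges
    inside [Q], and the same routes serve for every choice of the two sides. *)
Lemma has_biclique_detours (S Q X Y : {set T}) (f g : T -> T) a b :
  Q \subset S -> X \subset Q -> Y \subset Q -> [disjoint X & Y] ->
  {in Q &, forall x y, nonadj x y -> (x \in X /\ y \in Y) \/ (y \in X /\ x \in Y)} ->
  (forall y, y \in Y -> f y \in S :\: Q) -> {in Y &, injective f} ->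
  (forall x, x \in X -> g x \in S :\: Q) -> {in X &, injective g} ->
  (forall x y, x \in X -> y \in Y ->
    [/\ adj x (f y), adj (f y) (g x) & adj (g x) y]) ->
  a + b <= #|Q| -> has_biclique S a b.
Proof.
move=> QS XQ YQ dXY QP fS f_inj gS g_inj fg abQ.
have [A AQ cA] : exists2 A : {set T}, A \subset Q & #|A| = a.
  by apply: exists_subset_card; apply: leq_trans abQ; rewrite leq_addr.
have [B BQA cB] : exists2 B : {set T}, B \subset Q :\: A & #|B| = b.
  by apply: exists_subset_card; rewrite cardsDS // cA; lia.
have [BQ dAB] : B \subset Q /\ [disjoint A & B].
  by move: BQA; rewrite subsetD disjoint_sym => /andP[].
exists A, B; split; split=> //; try exact: subset_trans QS.
have inj_det x y x' y' e : x \in X -> y \in Y -> x' \in X -> y' \in Y ->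
    e \in detour x (f y) (g x) y -> e \in detour x' (f y') (g x') y' ->
    x = x' /\ y = y'.
  move=> xX yY x'X y'Y.
  have nQ z t : z \in Q -> t \in S :\: Q -> z <> t.
    by move=> zQ; rewrite inE => /andP[tQ _] E; rewrite -E zQ in tQ.
  have nXY z t : z \in X -> t \in Y -> z <> t.
    by move=> zX tY E; move/pred0P/(_ z): dXY; rewrite /= zX E tY.
  have nfg z t : z \in X -> t \in Y -> f t <> g z.
    by move=> zX tY E; case: (fg _ _ zX tY) => _; rewrite E adj_irr.
  have xQ := subsetP XQ _ xX; have x'Q := subsetP XQ _ x'X.
  have yQ := subsetP YQ _ yY; have y'Q := subsetP YQ _ y'Y.
  have ? := nQ _ _ xQ (fS _ y'Y); have ? := nQ _ _ x'Q (fS _ yY).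
  have ? := nQ _ _ xQ (gS _ x'X); have ? := nQ _ _ x'Q (gS _ xX).
  have ? := nQ _ _ yQ (fS _ y'Y); have ? := nQ _ _ y'Q (fS _ yY).
  have ? := nQ _ _ yQ (gS _ x'X); have ? := nQ _ _ y'Q (gS _ xX).
  have ? := nXY _ _ xX y'Y; have ? := nXY _ _ x'X yY.
  have ? := nfg _ _ xX y'Y; have ? := nfg _ _ x'X yY.
  have ? := f_inj _ _ yY y'Y; have ? := g_inj _ _ xX x'X.
  rewrite !inE -!orbA.
  by move=> /or3P[]/eqP-> /or3P[]/eqP/set2_eq; intuition congruence.
have det_out x y z t : x \in X -> y \in Y -> z \in Q -> t \in Q ->
    [set z; t] \in detour x (f y) (g x) y -> False.
  move=> xX yY zQ tQ.
  have nQ s : s \in S :\: Q -> z <> s /\ t <> s.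
    by rewrite inE => /andP[sQ _]; split=> E; rewrite -E ?zQ ?tQ in sQ.
  have [? ?] := nQ _ (fS _ yY); have [? ?] := nQ _ (gS _ xX).
  by rewrite !inE -!orbA => /or3P[]/eqP/set2_eq; intuition congruence.
pose F x y := if adj x y then [set [set x; y]] else
  if x \in X then detour x (f y) (g x) y else detour y (f x) (g y) x.
have FP x y : x \in A -> y \in B ->
  [\/ adj x y /\ F x y = [set [set x; y]],
      [/\ x \in X, y \in Y & F x y = detour x (f y) (g x) y] |
      [/\ y \in X, x \in Y & F x y = detour y (f x) (g y) x]].
  move=> xA yB; rewrite /F; case: ifP => xy; first by constructor 1.
  have xNy : x != y.
    by apply: contraTneq yB => <-; move/pred0P/(_ x): dAB; rewrite /= xA /= => ->.
  have /QP[] : nonadj x y by rewrite /nonadj xNy xy.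
  + exact: (subsetP AQ).
  + exact: (subsetP BQ).
  + by case=> -> yY; constructor 2.
  + case=> yX xY; constructor 3; case: ifP => // xX.
    by move/pred0P/(_ x): dXY; rewrite /= xX xY.
(* A route determines the unordered pair of its ends; as A and B are disjoint,
   the ordered pair follows. *)
have F_owner x y x' y' e : x \in A -> y \in B -> x' \in A -> y' \in B ->
    e \in F x y -> e \in F x' y' -> (x = x' /\ y = y') \/ (x = y' /\ y = x').
  move=> xA yB x'A y'B.
  have xQ := subsetP AQ _ xA; have x'Q := subsetP AQ _ x'A.
  have yQ := subsetP BQ _ yB; have y'Q := subsetP BQ _ y'B.
  case: (FP _ _ xA yB) => [[_ ->]|[xX yY ->]|[yX xY ->]];
  case: (FP _ _ x'A y'B) => [[_ ->]|[x'X y'Y ->]|[y'X x'Y ->]].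
  - by rewrite !inE => /eqP-> /eqP/set2_eq.
  - by rewrite inE => /eqP-> /det_out [].
  - by rewrite inE => /eqP-> /det_out [].
  - by move=> /[swap]; rewrite inE => /eqP-> /det_out [].
  - by move=> e1 e2; left; apply: inj_det e1 e2.
  - by move=> e1 e2; right; apply: inj_det e1 e2.
  - by move=> /[swap]; rewrite inE => /eqP-> /det_out [].
  - by move=> e1 e2; right; case: (inj_det _ _ _ _ _ yX xY x'X y'Y e1 e2).
  - by move=> e1 e2; left; case: (inj_det _ _ _ _ _ yX xY y'X x'Y e1 e2).
exists F; split.
- move=> x y xA yB; case: (FP _ _ xA yB) => [[xy ->]|[xX yY ->]|[yX xY ->]].
  + exact: connect_edge.
  + by case: (fg _ _ xX yY) => *; apply: connect_detour.
  + by rewrite within_connect_sym; case: (fg _ _ yX xY) => *; apply: connect_detour.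
- have inS (D : {set T}) x : D \subset Q -> x \in D -> x \in S.
    by move=> DQ xD; apply: (subsetP QS); apply: (subsetP DQ).
  have inSD x : x \in S :\: Q -> x \in S by rewrite inE => /andP[].
  move=> x y e xA yB; have xS := inS _ _ AQ xA; have yS := inS _ _ BQ yB.
  case: (FP _ _ xA yB) => [[xy ->]|[xX yY ->]|[yX xY ->]].
  + by rewrite inE => /eqP->; apply: sub_set2.
  + by apply: detour_sub => //; apply: inSD; auto.
  + by apply: detour_sub => //; apply: inSD; auto.
- move=> x y x' y' e xA yB x'A y'B e1 e2.
  case: (F_owner _ _ _ _ _ xA yB x'A y'B e1 e2) => // -[xy' _].
  by move/pred0P/(_ x): dAB; rewrite /= xA xy' y'B.
Qed.

Lemma has_biclique_clique (S Q : {set T}) a b :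
  Q \subset S -> {in Q &, forall x y, ~~ nonadj x y} -> a + b <= #|Q| ->
  has_biclique S a b.
Proof.
move=> QS QP; apply: (@has_biclique_detours _ Q set0 set0 id id);
  rewrite ?sub0set // ?disjoints_subset ?sub0set //; try by move=> ?; rewrite inE.
by move=> x y xQ yQ; move/negPf: (QP _ _ xQ yQ) => ->.
Qed.

(** * Non-adjacent pairs with few common neighbours *)

Definition nonnbrs (S : {set T}) u := [set w in S | nonadj w u].

Lemma has_biclique_nonnbrs (S : {set T}) u a b :
  a + b <= #|nonnbrs S u| -> has_biclique S a b.
Proof.
apply: has_biclique_clique; first by apply/subsetP=> w; rewrite inE => /andP[].
move=> x y; rewrite !inE => /andP[_ xu] /andP[_ yu]; apply/negP=> xy.
exact: no_triangle xy xu yu.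
Qed.

Lemma card_le_nonnbrs (S : {set T}) u v :
  #|S| <= #|nonnbrs S u| + #|nonnbrs S v| + #|common_nbrs S u v|.
Proof.
have SU : S \subset nonnbrs S u :|: nonnbrs S v :|: common_nbrs S u v.
  by apply/subsetP=> w wS; rewrite !inE wS /=; case: nonadj; case: nonadj.
by move: (subset_leq_card SU); rewrite !cardsU; clear; lia.
Qed.

(** The five vertices need not be required to be distinct: a closed walk of
    length 5 in a triangle-free graph is a 5-cycle. *)
Definition five_cycle (S : {set T}) v1 v2 v3 v4 v5 : bool :=
  [&& v1 \in S, v2 \in S, v3 \in S, v4 \in S & v5 \in S] &&
  [&& nonadj v1 v2, nonadj v2 v3, nonadj v3 v4, nonadj v4 v5 & nonadj v5 v1].

Lemma five_cycle_rot S v1 v2 v3 v4 v5 :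
  five_cycle S v1 v2 v3 v4 v5 -> five_cycle S v2 v3 v4 v5 v1.
Proof.
by rewrite /five_cycle => /andP[/and5P[-> -> -> -> ->] /and5P[-> -> -> -> ->]].
Qed.

(** Call a vertex a hit when a walk of length 2 in H joins it to [u]: two
    H-adjacent hits close up a walk of length 5, and so do two H-adjacent
    vertices joined to [v] by walks of length 2.  If two H-adjacent vertices
    are not hits and one of them, x', has no such walk to [v] either, then all
    H-neighbours of x' are among the fewer than [b] common neighbours of [u] and
    [v], which forces the other one to have at least [a + b] H-neighbours.
    Failing all this, hits and non-hits both form cliques of G. *)
Lemma has_biclique_or_five_cycle (S : {set T}) u v a b :
  u \in S -> v \in S -> nonadj u v ->
  (forall x y, x \in S -> y \in S -> nonadj x y -> #|common_nbrs S x y| < b) ->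
  b <= a -> (a + b).*2 <= #|S|.+1 ->
  has_biclique S a b \/
  exists v1 v2 v3 v4 v5, five_cycle S v1 v2 v3 v4 v5.
Proof.
move=> uS vS uv few ba abS.
pose hit z w := [exists p, [&& p \in S, nonadj w p & nonadj p z]].
have hitP z w : reflect (exists p, [/\ p \in S, nonadj w p & nonadj p z]) (hit z w).
  by apply: (iffP existsP) => -[p] /and3P; exists p.
have closed z w w' : z \in S -> w \in S -> w' \in S -> nonadj w w' ->
    hit z w -> hit z w' -> exists v1 v2 v3 v4 v5, five_cycle S v1 v2 v3 v4 v5.
  move=> zS wS w'S ww' /hitP[p [pS wp pz]] /hitP[p' [p'S wp' pz']].
  exists z, p, w, w', p'; rewrite /five_cycle zS pS wS w'S p'S.
  by rewrite nonadj_sym pz nonadj_sym wp ww' wp' pz'.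
pose P1 := [set w in S | hit u w]; pose P2 := [set w in S | ~~ hit u w].
have cP : #|S| <= #|P1| + #|P2|.
  have SU : S \subset P1 :|: P2.
    by apply/subsetP=> w wS; rewrite !inE wS /= orbN.
  by move: (subset_leq_card SU); rewrite cardsU; clear; lia.
have [PS1 PS2] : P1 \subset S /\ P2 \subset S.
  by split; apply/subsetP=> w; rewrite inE => /andP[].
have [|no_edge1] := boolP [exists x in P1, exists y in P1, nonadj x y].
  case/exists_inP=> x; rewrite inE => /andP[xS xu].
  case/exists_inP=> y; rewrite inE => /andP[yS yu] xy.
  by right; apply: closed xy xu yu.
have [|no_edge2] := boolP [exists x in P2, exists y in P2, nonadj x y].
  case/exists_inP=> x; rewrite inE => /andP[xS xu].
  case/exists_inP=> y; rewrite inE => /andP[yS yu] xy.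
  have far_from_both x' y' : x' \in S -> y' \in S -> nonadj x' y' -> ~~ hit u x' ->
      ~~ hit v x' -> has_biclique S a b.
    move=> xS' yS' xy' xu' xv'; apply: (@has_biclique_nonnbrs _ y').
    have NC : nonnbrs S x' \subset common_nbrs S u v.
      apply/subsetP=> w; rewrite !inE => /andP[wS wx]; rewrite wS /=.
      rewrite nonadj_sym in wx.
      by apply/andP; split; [apply: contra xu'|apply: contra xv'] => wz;
         apply/hitP; exists w.
    move: (leq_ltn_trans (subset_leq_card NC) (few _ _ uS vS uv)) abS ba.
    move: (few _ _ xS' yS' xy') (card_le_nonnbrs S x' y').
    by clear; lia.
  have [xv|xv] := boolP (hit v x); last by left; apply: far_from_both xy xu xv.
  have [yv|yv] := boolP (hit v y); first by right; apply: closed xy xv yv.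
  by left; rewrite nonadj_sym in xy; apply: far_from_both xy yu yv.
left; have cliq (P : {set T}) : ~~ [exists x in P, exists y in P, nonadj x y] ->
    {in P &, forall x y, ~~ nonadj x y}.
  move=> nP x y xP yP; apply: contra nP => xy.
  by apply/exists_inP; exists x => //; apply/exists_inP; exists y.
have [P1big|P1small] := leqP (a + b) #|P1|.
  exact: has_biclique_clique PS1 (cliq _ no_edge1) P1big.
apply: has_biclique_clique PS2 (cliq _ no_edge2) _.
by move: P1small cP abS; clear; lia.
Qed.

Definition common_nonnbrs (S : {set T}) u v :=
  [set w in S | nonadj w u & nonadj w v].

(** The vertices H-adjacent to two vertices of the cycle other than those in the
    first three sets are H-adjacent to [v2] and [v4], or to [v1] and [v4]: they
    avoid one of the edges v5 v1 and v2 v3, like the vertices H-adjacent to at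
    most one vertex of the cycle. *)
Lemma five_cycle_cover S v1 v2 v3 v4 v5 :
  five_cycle S v1 v2 v3 v4 v5 ->
  #|S| <= #|common_nonnbrs S v5 v2| + #|common_nonnbrs S v1 v3| +
          #|common_nonnbrs S v3 v5| + #|common_nbrs S v5 v1| +
          #|common_nbrs S v2 v3|.
Proof.
case/andP=> _ /and5P[e1 e2 e3 e4 e5].
have SU : S \subset common_nonnbrs S v5 v2 :|: common_nonnbrs S v1 v3 :|:
    common_nonnbrs S v3 v5 :|: common_nbrs S v5 v1 :|: common_nbrs S v2 v3.
  apply/subsetP=> w wS; rewrite !inE wS /=.
  have excl x y : nonadj x y -> ~~ (nonadj w x && nonadj w y).
    by move=> xy; apply/negP=> /andP[wx wy]; apply: no_triangle wx wy xy.
  move: (excl _ _ e1) (excl _ _ e2) (excl _ _ e5).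
  by do 4!case: (nonadj w _).
by move: (subset_leq_card SU); rewrite !cardsU; clear; lia.
Qed.

Ltac triangle :=
  match goal with
  | H1 : is_true (nonadj ?w ?x), H2 : is_true (nonadj ?w ?y),
    H3 : is_true (nonadj ?x ?y) |- _ =>
    exfalso; exact: (no_triangle H1 H2 H3)
  end.

(** The last hypothesis is |U_1| <= |U_5|, needed for an injection from U_1 to
    U_5.  The cover bound is used for U_1, U_2, U_4, which leaves enough room
    for [R] in U_2, and for U_3, U_4, U_1, which bounds |R| by |U_3|. *)
Lemma five_cycle_biclique_oriented S v1 v2 v3 v4 v5 a b :
  five_cycle S v1 v2 v3 v4 v5 ->
  (forall x y, x \in S -> y \in S -> nonadj x y -> #|common_nbrs S x y| < b) ->
  b <= a -> (a + b).*2 <= #|S|.+1 ->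
  #|common_nonnbrs S v5 v2| <= #|common_nonnbrs S v4 v1| ->
  has_biclique S a b.
Proof.
move=> C5 few ba abS U15.
have cov1 := five_cycle_cover C5.
have cov2 := five_cycle_cover (five_cycle_rot (five_cycle_rot C5)).
case/andP: (C5) => /and5P[s1 s2 s3 s4 s5] /and5P[e1 e2 e3 e4 e5].
have few1 := few _ _ s5 s1 e5; have few2 := few _ _ s2 s3 e2.
have few3 := few _ _ s4 s5 e4.
have UP x y w : w \in common_nonnbrs S x y -> [/\ w \in S, nonadj w x & nonadj w y].
  by rewrite inE => /and3P.
pose U1 := common_nonnbrs S v5 v2; pose U2 := common_nonnbrs S v1 v3.
pose U3 := common_nonnbrs S v2 v4; pose U4 := common_nonnbrs S v3 v5.
pose U5 := common_nonnbrs S v4 v1.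
rewrite -/U1 -/U2 -/U3 -/U4 -/U5 in cov1 cov2 U15.
have d14 : [disjoint U1 & U4].
  by apply/pred0P=> w /=; apply/negP=> /andP[/UP[_ ? ?] /UP[_ ? ?]]; triangle.
have c14 : #|U1 :|: U4| = #|U1| + #|U4| by apply/eqP; rewrite (leq_card_setU _ _).2.
(* The truncated subtraction makes R empty when U1 and U4 are large enough. *)
have [R RU cR] : exists2 R : {set T}, R \subset U2 & #|R| = a + b - (#|U1| + #|U4|).
  by apply: exists_subset_card; move: cov1 few1 few2 abS ba; clear; lia.
have RP w : w \in R -> [/\ w \in S, nonadj w v1 & nonadj w v3].
  by move/(subsetP RU)/UP.
have [f [fU f_inj]] : exists h : T -> T,
    (forall y, y \in R -> h y \in U3) /\ {in R &, injective h}.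
  by apply: exists_injection; rewrite cR; move: cov2 few2 few3 abS ba; clear; lia.
have [g [gU g_inj]] := exists_injection U15.
have d14R : [disjoint U1 :|: U4 & R].
  apply/pred0P=> w /=; apply/negP; rewrite in_setU => /andP[/orP[] /UP[_ ? ?] /RP[_ ? ?]];
    triangle.
have cQ : #|U1 :|: U4 :|: R| = #|U1| + #|U4| + #|R|.
  by rewrite -c14; apply/eqP; rewrite (leq_card_setU _ _).2.
have QP w : w \in U1 :|: U4 :|: R -> [\/ w \in U1, w \in U4 | w \in R].
  by rewrite !in_setU -orbA => /or3P.
apply: (@has_biclique_detours S (U1 :|: U4 :|: R) U1 R f g) => //.
- by apply/subsetP=> w /QP[/UP[]|/UP[]|/RP[]].
- by rewrite -setUA subsetUl.
- by rewrite subsetUr.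
- by move: d14R; rewrite !disjoints_subset subUset => /andP[].
- move=> x y /QP[xU|xU|xU] /QP[yU|yU|yU] xy; auto;
  by move/UP: xU || move/RP: xU; move/UP: yU || move/RP: yU; move=> [_ ? ?] [_ ? ?];
     rewrite nonadj_sym in xy; triangle.
- move=> y /fU/UP[fS ? ?]; rewrite in_setD fS andbT; apply/negP.
  by case/QP=> [/UP[_ ? ?]|/UP[_ ? ?]|/RP[_ ? ?]]; triangle.
- move=> x /gU/UP[gS ? ?]; rewrite in_setD gS andbT; apply/negP.
  by case/QP=> [/UP[_ ? ?]|/UP[_ ? ?]|/RP[_ ? ?]]; triangle.
- move=> x y xU yR; have [_ x5 x2] := UP _ _ _ xU; have [_ y1 y3] := RP _ yR.
  have [_ f2 f4] := UP _ _ _ (fU _ yR); have [_ g4 g1] := UP _ _ _ (gU _ xU).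
  split.
  + by apply: adj_of_common x2 f2 _; apply/eqP=> E; rewrite E in x5; triangle.
  + by apply: adj_of_common f4 g4 _; apply/eqP=> E; rewrite E in f2; triangle.
  + by apply: adj_of_common g1 y1 _; apply/eqP=> E; rewrite E in g4; triangle.
- by rewrite cQ cR; clear; lia.
Qed.

(** The sizes of U_1, U_5, U_4, U_3, U_2 cannot strictly decrease all the way
    round the cycle, so some rotation satisfies the inequality required. *)
Lemma five_cycle_biclique S v1 v2 v3 v4 v5 a b :
  five_cycle S v1 v2 v3 v4 v5 ->
  (forall x y, x \in S -> y \in S -> nonadj x y -> #|common_nbrs S x y| < b) ->
  b <= a -> (a + b).*2 <= #|S|.+1 -> has_biclique S a b.
Proof.
move=> C1 few ba abS.
have C2 := five_cycle_rot C1; have C3 := five_cycle_rot C2.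
have C4 := five_cycle_rot C3; have C5 := five_cycle_rot C4.
have step w1 w2 w3 w4 w5 (C : five_cycle S w1 w2 w3 w4 w5) :=
  five_cycle_biclique_oriented C few ba abS.
case: leqP (step _ _ _ _ _ C1) => [_ H|lt1 _]; first exact: H.
case: leqP (step _ _ _ _ _ C2) => [_ H|lt2 _]; first exact: H.
case: leqP (step _ _ _ _ _ C3) => [_ H|lt3 _]; first exact: H.
case: leqP (step _ _ _ _ _ C4) => [_ H|lt4 _]; first exact: H.
apply: (step _ _ _ _ _ C5).
move: lt1 lt2 lt3 lt4; clear; lia.
Qed.

Lemma has_biclique_half (S : {set T}) a b :
  (a + b).*2 <= #|S|.+1 -> has_biclique S a b.
Proof.
move: {2}(a + b) (erefl (a + b)) => N.
elim: N S a b => [|N IHN] S a b abN abS.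
  apply: (@has_biclique_clique S set0); rewrite ?sub0set ?abN //.
  by move=> x y; rewrite inE.
wlog ba : a b abN abS / b <= a.
  move=> wl; case: (leqP b a) => [|/ltnW ab]; first exact: wl.
  by apply: has_biclique_sym; apply: wl; rewrite // addnC.
have [|few] := boolP [exists u in S, exists v in S,
    nonadj u v && (b <= #|common_nbrs S u v|)].
  case/exists_inP=> u uS /exists_inP[v vS /andP[uv bC]].
  case: a abN abS ba => [|a] abN abS ba; first by move: abN ba; clear; lia.
  apply: (has_biclique_extend uS vS uv bC).
  have vSu : v \in S :\ u by rewrite !inE vS andbT eq_sym; case/andP: uv.
  apply: IHN; first by case: abN.
  by move: abS; rewrite (cardsD1 u) uS (cardsD1 v) vSu; clear; lia.
have {}few x y : x \in S -> y \in S -> nonadj x y -> #|common_nbrs S x y| < b.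
  move=> xS yS xy; rewrite ltnNge; apply: contra few => bC.
  by apply/exists_inP; exists x => //; apply/exists_inP; exists y; rewrite ?xy.
have [|no_edge] := boolP [exists u in S, exists v in S, nonadj u v].
  case/exists_inP=> u uS /exists_inP[v vS uv].
  have [//|[v1 [v2 [v3 [v4 [v5 C5]]]]]] := has_biclique_or_five_cycle uS vS uv few ba abS.
  exact: five_cycle_biclique C5 few ba abS.
apply: (@has_biclique_clique S S) => //; last by move: abN abS; clear; lia.
move=> x y xS yS; apply: contra no_edge => xy.
by apply/exists_inP; exists x => //; apply/exists_inP; exists y.
Qed.

End Linking.

(** * Immersions in multigraphs *)

Lemma adjacent_sym (G : mgraph) : symmetric (@adjacent G).
Proof. by move=> u v; apply: eq_existsb => e; rewrite setUC. Qed.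

Lemma adjacent_irr (G : mgraph) : irreflexive (@adjacent G).
Proof.
move=> u; apply/existsP=> -[e /eqP E].
by move: (card_ends e); rewrite E setUid cards1.
Qed.

Lemma nonadj_triangle_free_alpha2 (G : mgraph) :
  independence_number G <= 2 ->
  forall x y z, nonadj (@adjacent G) x y -> nonadj (@adjacent G) y z ->
    ~~ nonadj (@adjacent G) x z.
Proof.
move=> alpha x y z /andP[xy axy] /andP[yz ayz].
apply/negP=> /andP[xz axz].
have ind : independent [set x; y; z].
  apply/forall_inP=> u; rewrite !inE -orbA => uP.
  apply/forall_inP=> v; rewrite !inE -orbA => vP.
  case/or3P: uP => /eqP->; case/or3P: vP => /eqP->;
    by rewrite ?adjacent_irr // adjacent_sym.
have c3 : #|[set x; y; z]| = 3.
  by rewrite setUC cardsU1 cards2 !inE xy (eq_sym z) (eq_sym z) negb_or xz yz.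
have := leq_bigmax_cond (F := fun S : {set vertex G} => #|S|) _ ind.
by move/leq_trans/(_ alpha); rewrite c3.
Qed.

Lemma walk_of_path (G : mgraph) (F : {set {set vertex G}}) x p :
  path (within (@adjacent G) F) x p ->
  exists w : seq (edge G * vertex G),
    [/\ is_walk x w, unzip2 w = p
      & forall e, e \in walk_edges w -> ends e \in F].
Proof.
elim: p x => [|y p IHp] x /=; first by exists [::].
case/andP=> /andP[/existsP[e /eqP exy] xyF] /IHp[w [wW wp wF]].
exists ((e, y) :: w); split=> /=; first by rewrite exy eqxx.
  by rewrite wp.
by move=> e'; rewrite inE => /orP[/eqP->|/wF //]; rewrite exy.
Qed.

(** Routes with disjoint sets of vertex pairs remain edge-disjoint whichever
    parallel edges are chosen to realise the pairs. *)
Lemma immersion_of_has_biclique (G : mgraph) a b :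
  has_biclique (@adjacent G) setT a b -> contains_immersion G (Kbip a b).
Proof.
move=> [A [B [[_ _ dAB] [cA cB [F [F1 _ F3]]]]]].
pose fA (i : 'I_a) : vertex G := enum_val (cast_ord (esym cA) i).
pose fB (j : 'I_b) : vertex G := enum_val (cast_ord (esym cB) j).
have fAA i : fA i \in A by apply: enum_valP.
have fBB j : fB j \in B by apply: enum_valP.
have fA_inj : injective fA by move=> i j /enum_val_inj/cast_ord_inj.
have fB_inj : injective fB by move=> i j /enum_val_inj/cast_ord_inj.
have fAB i j : fA i <> fB j.
  by move=> E; move/pred0P/(_ (fA i)): dAB; rewrite /= fAA E fBB.
have walkP (e : 'I_a * 'I_b) : exists w : seq (edge G * vertex G),
    [/\ is_path (fA e.1) w, walk_target (fA e.1) w = fB e.2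
      & forall e', e' \in walk_edges w -> ends e' \in F (fA e.1) (fB e.2)].
  have /connectP[p pP] := F1 _ _ (fAA e.1) (fBB e.2).
  case/shortenP: pP => p' p'P p'U _ p'_last.
  have [w [wW wp wF]] := walk_of_path p'P.
  by exists w; split=> //; [rewrite /is_path wW wp|rewrite /walk_target wp].
have [P PP] := fin_all_exists walkP.
exists (fun z : 'I_a + 'I_b => match z with inl i => fA i | inr j => fB j end).
exists (fun e : 'I_a * 'I_b => fA e.1), P; split.
- move=> [i|j] [i'|j'].
  + by move/fA_inj->.
  + by move/fAB.
  + by move/esym/fAB.
  + by move/fB_inj->.
- by move=> e; case: (PP e).
- by move=> e; case: (PP e) => _ -> _; rewrite /= /Kbip_ends imsetU1 imset_set1.
- move=> e1 e2 ne; apply/pred0P=> e /=; apply/negP=> /andP[m1 m2].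
  have [_ _ /(_ _ m1) E1] := PP e1; have [_ _ /(_ _ m2) E2] := PP e2.
  have [/fA_inj i12 /fB_inj j12] := F3 _ _ _ _ _ (fAA _) (fBB _) (fAA _) (fBB _) E1 E2.
  by case/eqP: ne; case: e1 e2 i12 j12 {m1 m2 E1 E2} => ? ? [? ?] /= -> ->.
Qed.

Theorem theorem3 (G : mgraph) (n l : nat)
  (card_G : #|vertex G| = n)
  (alpha_G : independence_number G = 2)
  (l_gt0 : 0 < l)
  (l_le : l <= uphalf n - 1) :
  contains_immersion G (Kbip l (uphalf n - l)).
Proof.
apply: immersion_of_has_biclique; apply: has_biclique_half.
- exact: adjacent_sym.
- exact: adjacent_irr.
- by apply: nonadj_triangle_free_alpha2; rewrite alpha_G.
- have ln : l <= uphalf n by apply: leq_trans l_le (leq_subr _ _).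
  by rewrite subnKC // -geq_uphalf_double cardsT card_G.
Qed.
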